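(* Let $A$ be a Hopf coquasigroup over a field $k$ and let $M$ be a right $A$-Hopf module with action $m\otimes a\mapsto m\triangleleft a$ and coaction $\rho(m)=m^{(0)}\otimes m^{(1)}$. Let $\widehat{\rho}$ be the induced coaction on $M$ and $M^{\widehat{coA}}=\{m\in M\mid \widehat{\rho}(m)=m\otimes 1\}$. Then $M\cong M^{\widehat{coA}}\otimes A$ as right $A$-Hopf modules, where $M^{\widehat{coA}}\otimes A$ is a right $A$-Hopf module with action $(m\otimes a)\triangleleft b=m\otimes ab$ and coaction $m\otimes a\mapsto (m\otimes a_{(1)})\otimes a_{(2)}$, for all $a,b\in A$, $m\in M^{\widehat{coA}}$. The isomorphism is given by $$\sigma:M^{\widehat{coA}}\otimes A\to M,\quad m\otimes a\mapsto m\triangleleft a,$$ with inverse $$\sigma^{-1}:M\to M^{\widehat{coA}}\otimes A,\quad m\mapsto m^{(0)(0)}\triangleleft S(m^{(0)(1)})\otimes m^{(1)}.$$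
   Context: Let $k$ be a field. A Hopf coquasigroup over $k$ is a unital associative $k$-algebra $A$ with (unital) algebra homomorphisms $\Delta:A\to A\otimes A$ and $\varepsilon:A\to k$ such that $\Delta$ is counital with counit $\varepsilon$ (but not necessarily coassociative), and a linear map $S:A\to A$ (the antipode), such that for all $a\in A$, writing $\Delta a=a_{(1)}\otimes a_{(2)}$ (summation omitted) and using iterated indices for iterated coproducts, e.g. $(\mathrm{id}\otimes\Delta)\Delta a=a_{(1)}\otimes a_{(2)(1)}\otimes a_{(2)(2)}$: $$S(a_{(1)})a_{(2)(1)}\otimes a_{(2)(2)}=1\otimes a=a_{(1)}S(a_{(2)(1)})\otimes a_{(2)(2)},$$ $$a_{(1)(1)}\otimes S(a_{(1)(2)})a_{(2)}=a\otimes 1=a_{(1)(1)}\otimes a_{(1)(2)}S(a_{(2)}).$$ A right $A$-Hopf module is a vector space $M$ with linear maps $M\otimes A\to M$, $m\otimes a\mapsto m\triangleleft a$, and $\rho:M\to M\otimes A$, $m\mapsto m^{(0)}\otimes m^{(1)}$ (the coaction), such that $\triangleleft$ is an associative unital right action, and, writing $(\rho\otimes\mathrm{id})\rho(m)=m^{(0)(0)}\otimes m^{(0)(1)}\otimes m^{(1)}$, for all $m\in M$, $a\in A$: $m^{(0)(0)}\otimes S(m^{(0)(1)})m^{(1)}=m\otimes 1=m^{(0)(0)}\otimes m^{(0)(1)}S(m^{(1)})$, $\ m^{(0)}\varepsilon(m^{(1)})=m$, and $\rho(m\triangleleft a)=m^{(0)}\triangleleft a_{(1)}\otimes m^{(1)}a_{(2)}$.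 The induced coaction on a right $A$-Hopf module $M$ with coaction $\rho$ is $$\widehat{\rho}(m)=m^{(0)(0)}\triangleleft\big(S(m^{(0)(1)})\,m^{(1)}{}_{(1)}\big)\otimes m^{(1)}{}_{(2)};$$ it is known that $M$ with the same action and with the coaction $\widehat\rho$ is also a right $A$-Hopf module. An isomorphism of right $A$-Hopf modules is a linear bijection commuting with the actions and the coactions.
   Formalization: The isomorphism is for M with the induced coaction ρ̂ in place of ρ: with ρ itself the claim fails (A = functions on Z/3, ρ not coassociative), and σ commutes with ρ only if ρ = ρ̂. *)

(* Defs.v *)
From HB Require Import structures.
From mathcomp Require Import all_boot all_algebra.
From mathcomp Require Import boolp.

Set Implicit Arguments.
Unset Strict Implicit.
Unset Printing Implicit Defensive.

Import GRing.Theory.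
Local Open Scope ring_scope.
Local Open Scope quotient_scope.

Reserved Notation "U \ot V" (at level 40, left associativity).
Reserved Notation "\tsum_ ( x \ot y <- t ) E"
  (at level 41, x name, y name, t at level 200, E at level 41,
   format "'[' \tsum_ ( x  \ot  y  <-  t ) '/  '  E ']'").

Notation bilin f := (bilinear_for *:%R *:%R f).

(* The tensor product of two vector spaces: finite formal sums of pairs (u, v),
   encoded as lists, modulo the congruence generated by the bilinearity
   relations. *)
Section TensorProduct.
Variables (k : fieldType) (U V : lmodType k).
Implicit Types (u : U) (v : V) (c : k) (s : seq (U * V)).

Inductive tens_rel : seq (U * V) -> seq (U * V) -> Prop :=
  | tens_rel_refl s : tens_rel s s
  | tens_rel_sym s1 s2 : tens_rel s1 s2 -> tens_rel s2 s1
  | tens_rel_trans s1 s2 s3 :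
      tens_rel s1 s2 -> tens_rel s2 s3 -> tens_rel s1 s3
  | tens_rel_cat s1 s2 s3 s4 :
      tens_rel s1 s2 -> tens_rel s3 s4 -> tens_rel (s1 ++ s3) (s2 ++ s4)
  | tens_rel_catC s1 s2 : tens_rel (s1 ++ s2) (s2 ++ s1)
  | tens_rel_addl u1 u2 v :
      tens_rel [:: (u1 + u2, v)] [:: (u1, v); (u2, v)]
  | tens_rel_addr u v1 v2 :
      tens_rel [:: (u, v1 + v2)] [:: (u, v1); (u, v2)]
  | tens_rel_scale c u v : tens_rel [:: (c *: u, v)] [:: (u, c *: v)]
  | tens_rel_zero v : tens_rel [:: (0, v)] [::].

Definition tens_relb : rel (seq (U * V)) := fun s1 s2 => `[< tens_rel s1 s2 >].

Lemma tens_relb_refl : reflexive tens_relb.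
Proof. by move=> s; apply/asboolP/tens_rel_refl. Qed.

Lemma tens_relb_sym : symmetric tens_relb.
Proof. by move=> s1 s2; apply/asboolP/asboolP; apply: tens_rel_sym. Qed.

Lemma tens_relb_trans : transitive tens_relb.
Proof.
move=> s2 s1 s3 /asboolP h12 /asboolP h23; apply/asboolP.
exact: tens_rel_trans h12 h23.
Qed.

Canonical tens_equiv :=
  EquivRel tens_relb tens_relb_refl tens_relb_sym tens_relb_trans.

Definition tens := {eq_quot tens_equiv}.

HB.instance Definition _ := Choice.on tens.
HB.instance Definition _ := EqQuotient.on tens.

Definition tpure u v : tens := \pi_tens [:: (u, v)].
Definition tzero : tens := \pi_tens [::].
Definition tadd (x y : tens) : tens := \pi_tens (repr x ++ repr y).
Definition sscale c s : seq (U * V) := [seq (c *: p.1, p.2) | p <- s].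
Definition tscale c (x : tens) : tens := \pi_tens (sscale c (repr x)).
Definition topp (x : tens) : tens := tscale (-1) x.

Lemma tpiP s1 s2 : \pi_tens s1 = \pi_tens s2 <-> tens_rel s1 s2.
Proof.
split; first by move/eqmodP=> /asboolP.
by move=> h; apply/eqmodP/asboolP.
Qed.

Lemma tadd_pi s1 s2 : tadd (\pi_tens s1) (\pi_tens s2) = \pi_tens (s1 ++ s2).
Proof. by apply/tpiP/tens_rel_cat; apply/tpiP; rewrite reprK. Qed.

Lemma sscale_rel c s1 s2 :
  tens_rel s1 s2 -> tens_rel (sscale c s1) (sscale c s2).
Proof.
elim=> {s1 s2}.
- by move=> s; apply: tens_rel_refl.
- by move=> s1 s2 _; apply: tens_rel_sym.
- by move=> s1 s2 s3 _ h1 _; apply: tens_rel_trans.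
- by move=> s1 s2 s3 s4 _ h1 _ h2; rewrite /sscale !map_cat; apply: tens_rel_cat.
- by move=> s1 s2; rewrite /sscale !map_cat; apply: tens_rel_catC.
- by move=> u1 u2 v; rewrite /= scalerDr; apply: tens_rel_addl.
- by move=> u v1 v2; apply: tens_rel_addr.
- by move=> d u v; rewrite /= scalerA mulrC -scalerA; apply: tens_rel_scale.
- by move=> v; rewrite /= scaler0; apply: tens_rel_zero.
Qed.

Lemma tscale_pi c s : tscale c (\pi_tens s) = \pi_tens (sscale c s).
Proof. by apply/tpiP/sscale_rel/tpiP; rewrite reprK. Qed.

Lemma tens_reprP (x : tens) : exists s, x = \pi_tens s.
Proof. by exists (repr x); rewrite reprK. Qed.

Lemma taddA : associative tadd.
Proof.
move=> x y z; case: (tens_reprP x) (tens_reprP y) (tens_reprP z).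
by move=> s1 -> [s2 ->] [s3 ->]; rewrite !tadd_pi catA.
Qed.

Lemma taddC : commutative tadd.
Proof.
move=> x y; case: (tens_reprP x) (tens_reprP y) => s1 -> [s2 ->].
by rewrite !tadd_pi; apply/tpiP/tens_rel_catC.
Qed.

Lemma tadd0 : left_id tzero tadd.
Proof. by move=> x; case: (tens_reprP x) => s ->; rewrite tadd_pi. Qed.

Lemma tscaleDl x c d : tscale (c + d) x = tadd (tscale c x) (tscale d x).
Proof.
case: (tens_reprP x) => s ->; rewrite !tscale_pi tadd_pi; apply/tpiP.
elim: s => [|[u v] s IHs] /=; first exact: tens_rel_refl.
rewrite -cat1s -[_ :: (_ ++ _)]cat1s scalerDl.
apply: tens_rel_trans (tens_rel_cat (tens_rel_addl _ _ _) IHs) _.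
rewrite /= -(cat1s _ (_ :: _)) -[X in tens_rel _ X]cat1s.
apply: tens_rel_cat; first exact: tens_rel_refl.
rewrite -[sscale c s ++ _ :: _]cat_rcons -cats1 -cat1s catA.
by apply: tens_rel_cat; [apply: tens_rel_catC | apply: tens_rel_refl].
Qed.

Lemma tscale0 x : tscale 0 x = tzero.
Proof.
case: (tens_reprP x) => s ->; rewrite tscale_pi; apply/tpiP.
elim: s => [|[u v] s IHs] /=; first exact: tens_rel_refl.
by rewrite scale0r -cat1s; apply: tens_rel_cat (tens_rel_zero v) IHs.
Qed.

Lemma tscale1 : left_id 1 tscale.
Proof.
move=> x; case: (tens_reprP x) => s ->; rewrite tscale_pi; congr (\pi _).
by elim: s => //= -[u v] s /= ->; rewrite scale1r.
Qed.

Lemma tscaleA c d x : tscale c (tscale d x) = tscale (c * d) x.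
Proof.
case: (tens_reprP x) => s ->; rewrite !tscale_pi; congr (\pi _).
by rewrite /sscale -map_comp; apply: eq_map => p /=; rewrite scalerA.
Qed.

Lemma tscaleDr : right_distributive tscale tadd.
Proof.
move=> c x y; case: (tens_reprP x) (tens_reprP y) => s1 -> [s2 ->].
by rewrite !(tadd_pi, tscale_pi) /sscale map_cat.
Qed.

Lemma taddN : left_inverse tzero topp tadd.
Proof. by move=> x; rewrite -{2}[x]tscale1 -tscaleDl addNr tscale0. Qed.

HB.instance Definition _ := GRing.isZmodule.Build tens taddA taddC tadd0 taddN.
HB.instance Definition _ :=
  GRing.Zmodule_isLmodule.Build k tens tscaleA tscale1 tscaleDr
    (fun x c d => tscaleDl x c d).

Lemma tpure_bilin : bilin tpure.
Proof.
split=> [v c u1 u2|u c v1 v2] /=.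
  rewrite [c *: tpure _ _]tscale_pi [\pi_tens _ + _]tadd_pi.
  by apply/tpiP; apply: tens_rel_addl.
rewrite [c *: tpure _ _]tscale_pi [\pi_tens _ + _]tadd_pi; apply/tpiP.
apply: tens_rel_trans (tens_rel_addr _ _ _) _.
rewrite -cat1s -[X in tens_rel _ X]cat1s.
apply: tens_rel_cat; last exact: tens_rel_refl.
exact/tens_rel_sym/tens_rel_scale.
Qed.

Lemma tens_pi_sum s : \pi_tens s = \sum_(p <- s) tpure p.1 p.2.
Proof.
elim: s => [|[u v] s IHs]; first by rewrite big_nil.
by rewrite big_cons -IHs [_ + _]tadd_pi.
Qed.

Lemma tens_ind (P : tens -> Prop) :
  P 0 -> (forall u v x, P x -> P (tpure u v + x)) -> forall x, P x.
Proof.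
move=> P0 PD x; rewrite -[x]reprK tens_pi_sum.
by elim: (repr x) => [|[u v] s IHs]; rewrite ?big_nil // big_cons; apply: PD.
Qed.

End TensorProduct.

Notation "U \ot V" := (tens U V) : type_scope.
Notation "u \ot v" := (tpure u v) : ring_scope.

(* [\tsum_(x \ot y <- t) E] renders Sweedler's notation with the summation sign
   omitted: write t as a finite sum of pure tensors x \ot y and add up the
   values of E. When E is bilinear in (x, y), [tsum_linear] and [tsum_pure] show
   that the result does not depend on the chosen expression for t: it is the
   linear map on the tensor product given by the universal property. *)
Definition tsum (k : fieldType) (U V : lmodType k) (W : nmodType)
    (f : U -> V -> W) (t : (U \ot V)%type) : W :=
  \sum_(p <- repr t) f p.1 p.2.

Notation "\tsum_ ( x \ot y <- t ) E" := (tsum (fun x y => E) t) : ring_scope.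

Section TensorSum.
Variables (k : fieldType) (U V W : lmodType k) (f : U -> V -> W).
Hypothesis f_bilin : bilin f.

Lemma tsum_pi s : tsum f (\pi_(tens U V) s) = \sum_(p <- s) f p.1 p.2.
Proof.
have fDl v u1 u2 : f (u1 + u2) v = f u1 v + f u2 v.
  by have := f_bilin.1 v 1 u1 u2; rewrite /= !scale1r.
have fDr u v1 v2 : f u (v1 + v2) = f u v1 + f u v2.
  by have := f_bilin.2 u 1 v1 v2; rewrite /= !scale1r.
have f0l v : f 0 v = 0.
  by apply: (addrI (f 0 v)); rewrite -fDl !addr0.
have f0r u : f u 0 = 0.
  by apply: (addrI (f u 0)); rewrite -fDr !addr0.
have fZl c u v : f (c *: u) v = c *: f u v.
  by have := f_bilin.1 v c u 0; rewrite /= f0l !addr0.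
have fZr c u v : f u (c *: v) = c *: f u v.
  by have := f_bilin.2 u c v 0; rewrite /= f0r !addr0.
suff key s1 s2 : tens_rel s1 s2 ->
    \sum_(p <- s1) f p.1 p.2 = \sum_(p <- s2) f p.1 p.2.
  by apply: key; apply/tpiP; rewrite reprK.
elim=> {s s1 s2} //=.
- by move=> s1 s2 s3 _ -> _ ->.
- by move=> s1 s2 s3 s4 _ h1 _ h2; rewrite !big_cat h1 h2.
- by move=> s1 s2; rewrite !big_cat /= addrC.
- by move=> u1 u2 v; rewrite !(big_cons, big_nil) /= fDl !addr0.
- by move=> u v1 v2; rewrite !(big_cons, big_nil) /= fDr !addr0.
- by move=> c u v; rewrite !(big_cons, big_nil) /= fZl fZr.
- by move=> v; rewrite !(big_cons, big_nil) /= f0l addr0.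
Qed.

Lemma tsum_linear : linear (tsum f).
Proof.
move=> c x y; case: (tens_reprP x) (tens_reprP y) => s1 -> [s2 ->].
rewrite [c *: \pi_(tens U V) _]tscale_pi [\pi_(tens U V) _ + _]tadd_pi.
rewrite !tsum_pi big_cat scaler_sumr; congr (_ + _); rewrite big_map; apply: eq_bigr => p _ /=.
have f0 : f 0 p.2 = 0.
  apply: (addrI (f 0 p.2)); have := f_bilin.1 p.2 1 0 0.
  by rewrite /= !scale1r !addr0.
by have := f_bilin.1 p.2 c p.1 0; rewrite /= f0 !addr0.
Qed.

Lemma tsum_pure u v : tsum f (u \ot v) = f u v.
Proof. by rewrite tsum_pi big_seq1. Qed.

End TensorSum.

Lemma tsum_linear_fun (k : fieldType) (U V W X : lmodType k)
    (f : X -> U -> V -> W) (t : (U \ot V)%type) :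
  (forall u v, linear (fun x => f x u v)) -> linear (fun x => tsum (f x) t).
Proof.
move=> f_lin c x y; rewrite /tsum scaler_sumr -big_split /=.
by apply: eq_bigr => p _; rewrite f_lin.
Qed.

(* The algebra structure on a tensor product of two algebras. *)
Section TensorRing.
Variables (k : fieldType) (A B : algType k).

Definition tmul (s t : (A \ot B)%type) : (A \ot B)%type :=
  \tsum_(a1 \ot b1 <- s) \tsum_(a2 \ot b2 <- t) ((a1 * a2) \ot (b1 * b2)).

Let tmul_bilin2 (a1 : A) (b1 : B) :
  bilin (fun a2 b2 => (a1 * a2) \ot (b1 * b2)).
Proof.
split=> [b2|a2] c x y /=.
  by rewrite mulrDr -scalerAr (tpure_bilin A B).1.
by rewrite mulrDr -scalerAr (tpure_bilin A B).2.
Qed.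

Let tmul_bilin1 (t : (A \ot B)%type) :
  bilin (fun a1 b1 => \tsum_(a2 \ot b2 <- t) ((a1 * a2) \ot (b1 * b2))).
Proof.
split=> [b1|a1].
  apply: (@tsum_linear_fun _ _ _ _ _
    (fun a1 a2 b2 => (a1 * a2) \ot (b1 * b2))).
  by move=> a2 b2 c x y; rewrite mulrDl -scalerAl (tpure_bilin A B).1.
apply: (@tsum_linear_fun _ _ _ _ _
  (fun b1 a2 b2 => (a1 * a2) \ot (b1 * b2))).
by move=> a2 b2 c x y; rewrite mulrDl -scalerAl (tpure_bilin A B).2.
Qed.

Let tmul_linearl t : linear (tmul^~ t).
Proof. exact: tsum_linear (tmul_bilin1 t). Qed.

Let tmul_linearr s : linear (tmul s).
Proof.
apply: (@tsum_linear_fun _ _ _ _ _ (fun t a1 b1 =>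
  \tsum_(a2 \ot b2 <- t) ((a1 * a2) \ot (b1 * b2)))).
by move=> a1 b1; apply: tsum_linear.
Qed.

Lemma tmul_pure a1 b1 a2 b2 :
  tmul (a1 \ot b1) (a2 \ot b2) = (a1 * a2) \ot (b1 * b2).
Proof. by rewrite /tmul !tsum_pure. Qed.

Lemma tmulDl : left_distributive tmul +%R.
Proof. by move=> x y z; have := tmul_linearl z 1 x y; rewrite /= !scale1r. Qed.

Lemma tmulDr : right_distributive tmul +%R.
Proof. by move=> x y z; have := tmul_linearr x 1 y z; rewrite /= !scale1r. Qed.

Let tmul0 x : tmul x 0 = 0.
Proof. by apply: (addrI (tmul x 0)); rewrite -tmulDr !addr0. Qed.

Let t0mul x : tmul 0 x = 0.
Proof. by apply: (addrI (tmul 0 x)); rewrite -tmulDl !addr0. Qed.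

Lemma tmulA : associative tmul.
Proof.
elim/tens_ind=> [y z|a1 b1 x IHx y z]; first by rewrite !t0mul.
rewrite !tmulDl IHx; congr (_ + _); move: y z => {x IHx}.
elim/tens_ind=> [z|a2 b2 y IHy z]; first by rewrite tmul0 !t0mul tmul0.
rewrite tmulDl !tmulDr tmulDl IHy; congr (_ + _); move: z => {y IHy}.
elim/tens_ind=> [|a3 b3 z IHz]; first by rewrite !tmul0.
by rewrite !tmulDr IHz !tmul_pure !mulrA.
Qed.

Lemma tmul1l : left_id (1 \ot 1) tmul.
Proof.
elim/tens_ind=> [|a b x IHx]; first exact: tmul0.
by rewrite tmulDr IHx tmul_pure !mul1r.
Qed.

Lemma tmul1r : right_id (1 \ot 1) tmul.
Proof.
elim/tens_ind=> [|a b x IHx]; first exact: t0mul.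
by rewrite tmulDl IHx tmul_pure !mulr1.
Qed.

HB.instance Definition _ := GRing.Zmodule_isPzRing.Build (A \ot B)%type
  tmulA tmul1l tmul1r tmulDl tmulDr.

End TensorRing.

Record hopfCoquasigroup (k : fieldType) := HopfCoquasigroup {
  coqg_alg :> algType k;
  comul : {linear coqg_alg -> (coqg_alg \ot coqg_alg)%type};
  counit : {lrmorphism coqg_alg -> k^o};
  antipode : {linear coqg_alg -> coqg_alg};
  comul_monoid_morphism : monoid_morphism comul;
  comul_counitl : forall a, \tsum_(a1 \ot a2 <- comul a) (counit a1 *: a2) = a;
  comul_counitr : forall a, \tsum_(a1 \ot a2 <- comul a) (counit a2 *: a1) = a;
  antipode_ll : forall a,
    \tsum_(a1 \ot a2 <- comul a) \tsum_(a21 \ot a22 <- comul a2)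
      ((antipode a1 * a21) \ot a22) = 1 \ot a;
  antipode_lr : forall a,
    \tsum_(a1 \ot a2 <- comul a) \tsum_(a21 \ot a22 <- comul a2)
      ((a1 * antipode a21) \ot a22) = 1 \ot a;
  antipode_rl : forall a,
    \tsum_(a1 \ot a2 <- comul a) \tsum_(a11 \ot a12 <- comul a1)
      (a11 \ot (antipode a12 * a2)) = a \ot 1;
  antipode_rr : forall a,
    \tsum_(a1 \ot a2 <- comul a) \tsum_(a11 \ot a12 <- comul a1)
      (a11 \ot (a12 * antipode a2)) = a \ot 1 }.

Arguments comul {k h}.
Arguments counit {k h}.
Arguments antipode {k h}.

Record is_hopf_module (k : fieldType) (A : hopfCoquasigroup k) (M : lmodType k)
    (act : M -> A -> M) (coact : M -> (M \ot A)%type) : Prop := IsHopfModule {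
  hm_act_bilin : bilin act;
  hm_coact_linear : linear coact;
  hm_actA : forall m a b, act (act m a) b = act m (a * b);
  hm_act1 : forall m, act m 1 = m;
  hm_antipodel : forall m,
    \tsum_(m0 \ot m1 <- coact m) \tsum_(m00 \ot m01 <- coact m0)
      (m00 \ot (antipode m01 * m1)) = m \ot 1;
  hm_antipoder : forall m,
    \tsum_(m0 \ot m1 <- coact m) \tsum_(m00 \ot m01 <- coact m0)
      (m00 \ot (m01 * antipode m1)) = m \ot 1;
  hm_counit : forall m, \tsum_(m0 \ot m1 <- coact m) (@counit k A m1 *: m0) = m;
  hm_coact_act : forall m a,
    coact (act m a) =
    \tsum_(m0 \ot m1 <- coact m) \tsum_(a1 \ot a2 <- comul a)
      (act m0 a1 \ot (m1 * a2)) }.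

Record hopfModule (k : fieldType) (A : hopfCoquasigroup k) := HopfModule {
  hm_sort :> lmodType k;
  hm_act : hm_sort -> A -> hm_sort;
  hm_coact : hm_sort -> (hm_sort \ot A)%type;
  hmP : is_hopf_module hm_act hm_coact }.

Record is_hopf_module_iso (k : fieldType) (A : hopfCoquasigroup k)
    (M N : lmodType k) (actM : M -> A -> M) (coactM : M -> (M \ot A)%type)
    (actN : N -> A -> N) (coactN : N -> (N \ot A)%type) (f : M -> N) : Prop :=
  IsHopfModuleIso {
    hmi_linear : linear f;
    hmi_bij : bijective f;
    hmi_act : forall m a, f (actM m a) = actN (f m) a;
    hmi_coact : forall m,
      coactN (f m) = \tsum_(m0 \ot m1 <- coactM m) (f m0 \ot m1) }.

Section Coinvariants.
Variables (k : fieldType) (A : hopfCoquasigroup k) (M : hopfModule A).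

(* Hopf modules need not be coassociative, and [sigma] below need not commute
   with [hm_coact]: for A the functions on a finite group G, [hm_coact] is a
   family of maps T_g with T_(g^-1) T_g = 1 but possibly T_g T_h <> T_(gh). It is
   for the induced coaction that M is isomorphic to a free Hopf module. *)
Definition induced_coact (m : M) : (M \ot A)%type :=
  \tsum_(m0 \ot m1 <- hm_coact m) \tsum_(m00 \ot m01 <- hm_coact m0)
    \tsum_(m11 \ot m12 <- comul m1)
      (hm_act m00 (antipode m01 * m11) \ot m12).

Lemma induced_coact_linear : linear induced_coact.
Proof.
have actDl m a c n :
    hm_act (c *: m + n) a = c *: hm_act m a + hm_act n a :> M.
  exact: (hm_act_bilin (hmP M)).1.
have actDr m a c b :
    hm_act m (c *: a + b) = c *: hm_act m a + hm_act m b :> M.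
  exact: (hm_act_bilin (hmP M)).2.
have coactP := hm_coact_linear (hmP M).
have bil3 (m00 : M) (m01 : A) : bilin (fun m11 m12 : A =>
    hm_act m00 (antipode m01 * m11) \ot m12).
  split=> [x|x] c y z /=.
    by rewrite mulrDr -scalerAr actDr (tpure_bilin M A).1.
  by rewrite (tpure_bilin M A).2.
have bil2 (m1 : A) : bilin (fun (m00 : M) (m01 : A) =>
    \tsum_(m11 \ot m12 <- comul m1)
      (hm_act m00 (antipode m01 * m11) \ot m12)).
  split=> [x|x].
    apply: (@tsum_linear_fun _ _ _ _ _ (fun m00 m11 m12 =>
      hm_act m00 (antipode x * m11) \ot m12)) => a b c y z /=.
    by rewrite actDl (tpure_bilin M A).1.
  apply: (@tsum_linear_fun _ _ _ _ _ (fun m01 m11 m12 =>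
    hm_act x (antipode m01 * m11) \ot m12)) => a b c y z /=.
  by rewrite linearP mulrDl -scalerAl actDr (tpure_bilin M A).1.
have bil1 : bilin (fun (m0 : M) (m1 : A) =>
    \tsum_(m00 \ot m01 <- hm_coact m0) \tsum_(m11 \ot m12 <- comul m1)
      (hm_act m00 (antipode m01 * m11) \ot m12)).
  split=> [x c y z|x] /=.
    by rewrite coactP (tsum_linear (bil2 x)).
  apply: (@tsum_linear_fun _ _ _ _ _ (fun m1 m00 m01 =>
    \tsum_(m11 \ot m12 <- comul m1)
      (hm_act m00 (antipode m01 * m11) \ot m12))) => a b c y z /=.
  by rewrite linearP (tsum_linear (bil3 a b)).
by move=> c m n; rewrite /induced_coact coactP (tsum_linear bil1).
Qed.

Definition coinvariant : pred M := fun m => induced_coact m == m \ot 1.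

Lemma coinvariant_submod_closed : submod_closed coinvariant.
Proof.
have coact0 : induced_coact 0 = 0.
  have := induced_coact_linear 1 0 0; rewrite !scale1r !addr0 => h.
  by apply: (addrI (induced_coact 0)); rewrite -h addr0.
split=> [|c m n].
  rewrite unfold_in /coinvariant coact0; apply/eqP; apply/esym.
  have := (tpure_bilin M A).1 1 1 0 0; rewrite /= !scale1r !addr0 => h.
  by apply: (addrI (0 \ot (1 : A))); rewrite -h addr0.
rewrite !unfold_in /coinvariant induced_coact_linear => /eqP-> /eqP->.
by rewrite -(tpure_bilin M A).1.
Qed.

HB.instance Definition _ :=
  GRing.isSubmodClosed.Build k M coinvariant coinvariant_submod_closed.

Record coinv := Coinv { coinv_val :> M; coinvP : coinvariant coinv_val }.

HB.instance Definition _ := [isSub for coinv_val].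
HB.instance Definition _ := [Choice of coinv by <:].
HB.instance Definition _ := [SubChoice_isSubLmodule of coinv by <:].

Definition coinv_tens_act (t : (coinv \ot A)%type) (b : A) :
    (coinv \ot A)%type :=
  \tsum_(m \ot a <- t) (m \ot (a * b)).

Definition coinv_tens_coact (t : (coinv \ot A)%type) :
    ((coinv \ot A) \ot A)%type :=
  \tsum_(m \ot a <- t) \tsum_(a1 \ot a2 <- comul a) ((m \ot a1) \ot a2).

Definition sigma (t : (coinv \ot A)%type) : M :=
  \tsum_(m \ot a <- t) hm_act (coinv_val m) a.

End Coinvariants.

Arguments induced_coact {k A M}.
Arguments coinv_tens_act {k A M}.
Arguments coinv_tens_coact {k A M}.

(* Main.v *)
Require Import Defs.
From mathcomp Require Import all_boot all_algebra.

Set Implicit Arguments.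
Unset Strict Implicit.
Unset Printing Implicit Defensive.

Import GRing.Theory.
Local Open Scope ring_scope.

(** The theorem rests on one map, the projection
      P m = m0 <| S(m1)
    of M onto its coinvariants, written with the summation sign omitted.

    The antipode of a Hopf coquasigroup reverses products and satisfies
    a1 S(a2) = eps(a) 1; together with the compatibility of the coaction with
    the action this gives P (m <| a) = eps(a) P m. So P kills the action, and
    the map phi m = P m0 \ot m1 from M to M \ot A is A-linear:
    phi (m <| a) = phi m . a, where A acts on the right-hand factor. The two
    antipode axioms of a Hopf module then have transparent meanings: one says
    that P m0 <| m1 = m, i.e. that acting undoes phi, the other says that
    phi (P m) = P m \ot 1.

    By associativity of the action, the induced coaction is phi followed by
    u \ot a |-> (u <| a1) \ot a2. Hence phi (P m) = P m \ot 1 makes every P m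
    coinvariant. Conversely, applying P to the left-hand factor of the induced
    coaction gives back phi, because P (u <| a1) \ot a2 collapses to P u \ot a;
    so a coinvariant m has phi m = P m \ot 1, and acting shows m = P m. Read
    with values in the coinvariants, phi is therefore a two-sided inverse of
    sigma: sigma (phi m) = P m0 <| m1 = m, and
    phi (m <| a) = phi m . a = m \ot a for m coinvariant.

    That sigma respects the coactions comes from the same description of the
    induced coaction. The coinvariants tensored with A form a Hopf module by the
    axioms of A alone; transporting this structure along sigma shows that the
    induced coaction makes M a Hopf module too.

    The sums over tensors may be manipulated as in Sweedler's notation because
    all summands are multilinear. *)

(** * Calculus of sums over tensors *)

Section Sums.
Variable k : fieldType.

Lemma eq_tsum (U V : lmodType k) (W : nmodType) (f g : U -> V -> W)
    (t : (U \ot V)%type) :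
  (forall u v, f u v = g u v) -> tsum f t = tsum g t.
Proof. by move=> fg; apply: eq_bigr => p _; apply: fg. Qed.

Lemma scaler_tsum (U V W : lmodType k) (f : U -> V -> W)
    (t : (U \ot V)%type) (c : k) :
  c *: tsum f t = \tsum_(u \ot v <- t) (c *: f u v).
Proof. exact: scaler_sumr. Qed.

Lemma exchange_tsum (U V X Y : lmodType k) (W : nmodType)
    (f : U -> V -> X -> Y -> W) (s : (U \ot V)%type) (t : (X \ot Y)%type) :
  \tsum_(u \ot v <- s) \tsum_(x \ot y <- t) f u v x y =
  \tsum_(x \ot y <- t) \tsum_(u \ot v <- s) f u v x y.
Proof. exact: exchange_big. Qed.

(** Folding linearity into a constant lets hypotheses and goals about it be
    recognised syntactically by the tactic [lin] below. *)
Definition is_linear (U V : lmodType k) (f : U -> V) : Prop := linear f.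
Definition is_bilinear (U V W : lmodType k) (f : U -> V -> W) :=
  bilinear_for *:%R *:%R f.

Lemma lin_comp (X U V : lmodType k) (f : U -> V) (h : X -> U) :
  is_linear f -> is_linear h -> is_linear (fun x => f (h x)).
Proof. by move=> fP hP c x y; rewrite hP fP. Qed.

Lemma lin_id (U : lmodType k) : is_linear (fun x : U => x).
Proof. by []. Qed.

Section Closure.
Variables X U V W : lmodType k.

Lemma lin_bilinl (f : U -> V -> W) (h : X -> U) (v : V) :
  is_bilinear f -> is_linear h -> is_linear (fun x => f (h x) v).
Proof. by move=> fP hP c x y; rewrite hP fP.1. Qed.

Lemma lin_bilinr (f : U -> V -> W) (u : U) (h : X -> V) :
  is_bilinear f -> is_linear h -> is_linear (fun x => f u (h x)).
Proof. by move=> fP hP c x y; rewrite hP fP.2. Qed.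

Lemma lin_linear (f : {linear U -> V}) : is_linear f.
Proof. exact: linearP. Qed.

Lemma lin_tpurel (h : X -> U) (v : V) :
  is_linear h -> is_linear (fun x => h x \ot v).
Proof. by move=> hP c x y; rewrite hP (tpure_bilin U V).1. Qed.

Lemma lin_tpurer (u : U) (h : X -> V) :
  is_linear h -> is_linear (fun x => u \ot h x).
Proof. by move=> hP c x y; rewrite hP (tpure_bilin U V).2. Qed.

Lemma lin_scalel (f : X -> k^o) (v : V) :
  is_linear f -> is_linear (fun x => (f x : k) *: v).
Proof. by move=> fP c x y; rewrite fP scalerDl scalerA. Qed.

Lemma lin_scaler (c : k) (h : X -> V) :
  is_linear h -> is_linear (fun x => c *: h x).
Proof. by move=> hP d x y; rewrite hP scalerDr !scalerA mulrC. Qed.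

Lemma lin_tsum (f : U -> V -> W) (h : X -> (U \ot V)%type) :
  (forall v, is_linear (f^~ v)) -> (forall u, is_linear (f u)) ->
  is_linear h -> is_linear (fun x => tsum f (h x)).
Proof. by move=> fl fr; apply: lin_comp; apply: tsum_linear. Qed.

Lemma lin_tsum_body (f : X -> U -> V -> W) (t : (U \ot V)%type) :
  (forall u v, is_linear (fun x => f x u v)) ->
  is_linear (fun x => tsum (f x) t).
Proof. exact: tsum_linear_fun. Qed.

Section LinearFunctions.
Variables (f : U -> V) (f_lin : is_linear f).

Lemma is_linear0 : f 0 = 0.
Proof.
by apply: (addrI (f 0)); have := f_lin 1 0 0; rewrite !scale1r !addr0.
Qed.

Lemma is_linearD u v : f (u + v) = f u + f v.
Proof. by have := f_lin 1 u v; rewrite !scale1r. Qed.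

Lemma is_linearZ c u : f (c *: u) = c *: f u.
Proof. by have := f_lin c u 0; rewrite is_linear0 !addr0. Qed.

Lemma is_linear_tsum (P Q : lmodType k) (g : P -> Q -> U) (t : (P \ot Q)%type) :
  f (tsum g t) = \tsum_(x \ot y <- t) f (g x y).
Proof. exact: (big_morph f is_linearD is_linear0). Qed.

End LinearFunctions.
End Closure.

Lemma lin_mull (X : lmodType k) (A : algType k) (h : X -> A) (b : A) :
  is_linear h -> is_linear (fun x => h x * b).
Proof. by move=> hP c x y; rewrite hP mulrDl scalerAl. Qed.

Lemma lin_mulr (X : lmodType k) (A : algType k) (b : A) (h : X -> A) :
  is_linear h -> is_linear (fun x => b * h x).
Proof. by move=> hP c x y; rewrite hP mulrDr scalerAr. Qed.

Lemma tsum_tpure (U V W : lmodType k) (f : U -> V -> W) (u : U) (v : V) :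
  is_bilinear f -> tsum f (u \ot v) = f u v.
Proof. by move=> fP; rewrite (tsum_pure fP). Qed.

Lemma tsum_tsum (U V P Q W : lmodType k) (f : P -> Q -> W)
    (g : U -> V -> (P \ot Q)%type) (t : (U \ot V)%type) :
  is_bilinear f ->
  tsum f (\tsum_(u \ot v <- t) g u v) = \tsum_(u \ot v <- t) tsum f (g u v).
Proof.
by move=> fP; apply: (is_linear_tsum (f := tsum f) (tsum_linear fP)).
Qed.

(** These are the rules by which an identity between tensors is used: apply the
    linear map induced by a bilinear [f] to both sides, and push it through the
    sums onto the pure tensors. *)
Section Substitution.
Variables (U V X Y P Q W : lmodType k) (f : P -> Q -> W).
Hypothesis f_bilin : is_bilinear f.

Lemma tsum_subst (p : U -> V -> P) (q : U -> V -> Q) (t : (U \ot V)%type) :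
  tsum f (\tsum_(u \ot v <- t) (p u v \ot q u v)) =
  \tsum_(u \ot v <- t) f (p u v) (q u v).
Proof. by rewrite tsum_tsum //; apply: eq_tsum => u v; rewrite tsum_tpure. Qed.

Lemma tsum_subst2 (s : U -> V -> (X \ot Y)%type)
    (p : U -> V -> X -> Y -> P) (q : U -> V -> X -> Y -> Q)
    (t : (U \ot V)%type) :
  tsum f (\tsum_(u \ot v <- t) \tsum_(z \ot w <- s u v)
    (p u v z w \ot q u v z w)) =
  \tsum_(u \ot v <- t) \tsum_(z \ot w <- s u v) f (p u v z w) (q u v z w).
Proof.
rewrite tsum_tsum //; apply: eq_tsum => u v; rewrite tsum_tsum //.
by apply: eq_tsum => z w; rewrite tsum_tpure.
Qed.

Lemma tsum2_contract (s : U -> V -> (X \ot Y)%type)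
    (p : U -> V -> X -> Y -> P) (q : U -> V -> X -> Y -> Q)
    (t : (U \ot V)%type) (x : P) (y : Q) :
  \tsum_(u \ot v <- t) \tsum_(z \ot w <- s u v) (p u v z w \ot q u v z w)
    = x \ot y ->
  \tsum_(u \ot v <- t) \tsum_(z \ot w <- s u v) f (p u v z w) (q u v z w)
    = f x y.
Proof. by move=> e; rewrite -tsum_subst2 e tsum_tpure. Qed.

End Substitution.

Lemma tens_linear_ext (U V W : lmodType k) (f g : (U \ot V)%type -> W) :
  is_linear f -> is_linear g -> (forall u v, f (u \ot v) = g (u \ot v)) ->
  f =1 g.
Proof.
move=> fP gP fg; elim/tens_ind => [|u v t IHt]; first by rewrite !is_linear0.
by rewrite !is_linearD // IHt fg.
Qed.

End Sums.

(** [lin] proves that an expression is linear in a variable occurring once, by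
    following the path from the root of the expression to that variable; maps
    other than the built-in ones are recognised by a hypothesis in the context
    stating that they are linear or bilinear. *)
Ltac lin :=
  cbv beta;
  first
    [ exact: lin_id
    | apply: lin_tpurel; lin | apply: lin_tpurer; lin
    | apply: lin_scalel; lin | apply: lin_scaler; lin
    | apply: lin_mull; lin | apply: lin_mulr; lin
    | apply: lin_tsum_body => ? ?; lin | apply: lin_tsum => [?|?|]; lin
    | apply: (lin_comp (lin_linear _)); lin
    | match goal with
      | H : is_linear _ |- _ => apply: (lin_comp H); lin
      | H : is_bilinear _ |- _ => apply: (lin_bilinl _ H); lin
      | H : is_bilinear _ |- _ => apply: (lin_bilinr _ H); lin
      end ].
Ltac bilin := split=> ?; lin.

(** * The antipode of a Hopf coquasigroup *)

Section Antipode.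
Variables (k : fieldType) (A : hopfCoquasigroup k).
Implicit Types a b : A.

(** The counit takes its values in [k^o], so the scalings in the axioms are over
    [k^o]; the three counit axioms are restated with scalings over [k], which
    rewriting does not identify with the former. *)
Lemma counitl a : \tsum_(a1 \ot a2 <- comul a) ((counit a1 : k) *: a2) = a.
Proof. exact: comul_counitl. Qed.

Lemma counitr a : \tsum_(a1 \ot a2 <- comul a) ((counit a2 : k) *: a1) = a.
Proof. exact: comul_counitr. Qed.

Lemma hopf_module_counit (M : lmodType k) (act : M -> A -> M)
    (coact : M -> (M \ot A)%type) (m : M) :
  is_hopf_module act coact ->
  \tsum_(m0 \ot m1 <- coact m) ((counit (m1 : A) : k) *: m0) = m.
Proof. by move=> P; exact: hm_counit P m. Qed.

(** Apply the counit to the last factor of a1 S(a21) \ot a22 = 1 \ot a. *)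
Lemma antipode_mulr a :
  \tsum_(a1 \ot a2 <- comul a) (a1 * antipode a2) = (counit a : k) *: 1.
Proof.
have f_bilin : is_bilinear (fun x y : A => (counit y : k) *: x) by bilin.
rewrite -(tsum2_contract f_bilin (antipode_lr a)).
apply: eq_tsum => a1 a2; rewrite -{1}[a2]counitr.
rewrite (is_linear_tsum (f := fun x => a1 * antipode x)); last by lin.
by apply: eq_tsum => x y; rewrite linearZ /= -scalerAr.
Qed.

Lemma comulM a b :
  comul (a * b) =
  \tsum_(a1 \ot a2 <- comul a) \tsum_(b1 \ot b2 <- comul b)
    ((a1 * b1) \ot (a2 * b2)).
Proof. exact: (comul_monoid_morphism A).2. Qed.

(** The usual argument by uniqueness of convolution inverses needs
    coassociativity. Instead, S(ab) is expanded with the identity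
    S(x1) x21 \ot x22 = 1 \ot x, for x = b and then for x = a, which gives
      S(ab) = S(b1) S(a1) a21 b21 S(a22 b22).
    Here a21 b21 S(a22 b22) is c1 S(c2) for c = a2 b2, hence the scalar
    eps(a2 b2), and the counit axiom finishes. *)
Lemma antipodeM a b : antipode (a * b) = antipode b * antipode a.
Proof.
have f_bilin : is_bilinear (fun x y : A => x * antipode (a * y)) by bilin.
have g_bilin : is_bilinear (fun x y : A =>
    \tsum_(b1 \ot b2 <- comul b) \tsum_(b21 \ot b22 <- comul b2)
      (antipode b1 * x * b21 * antipode (y * b22))) by bilin.
have h_bilin : is_bilinear (fun x y : A => x * antipode y) by bilin.
(* the factor 1 is the slot x of the bilinear map above, used next for x = a *)
transitivity (\tsum_(b1 \ot b2 <- comul b) \tsum_(b21 \ot b22 <- comul b2)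
      (antipode b1 * 1 * b21 * antipode (a * b22))).
  rewrite -[LHS]mul1r -(tsum2_contract f_bilin (antipode_ll b)).
  by apply: eq_tsum => b1 b2; apply: eq_tsum => b21 b22; rewrite mulr1.
rewrite -(tsum2_contract g_bilin (antipode_ll a)).
transitivity (tsum (fun a1 a2 : A => tsum (fun b1 b2 : A =>
  antipode b1 * antipode a1 * (counit (a2 * b2) : k)%:A) (comul b)) (comul a)).
  apply: eq_tsum => a1 a2; rewrite exchange_tsum; apply: eq_tsum => b1 b2.
  have mul_lin : is_linear (fun x => antipode b1 * antipode a1 * x) by lin.
  rewrite -antipode_mulr comulM tsum_subst2 // (is_linear_tsum mul_lin).
  apply: eq_tsum => a21 a22; rewrite (is_linear_tsum mul_lin).
  by apply: eq_tsum => b21 b22; rewrite !mulrA.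
rewrite -{2}[a]counitr -{2}[b]counitr exchange_tsum.
rewrite (is_linear_tsum (f := fun x => antipode x * _)); last by lin.
apply: eq_tsum => b1 b2.
rewrite (is_linear_tsum (f := fun x => _ * antipode x)); last by lin.
apply: eq_tsum => a1 a2.
by rewrite !linearZ /= -scalerAl -!scalerAr mulr1 scalerA rmorphM mulrC.
Qed.

End Antipode.

(** * Transport of Hopf module structures *)

Section Transport.
Variables (k : fieldType) (A : hopfCoquasigroup k) (N M : lmodType k).
Variables (actN : N -> A -> N) (coactN : N -> (N \ot A)%type).
Variables (actM : M -> A -> M) (coactM : M -> (M \ot A)%type).
Variable f : N -> M.

(** The structure maps of M are conjugate to those of N under [f], so that their
    linearity, too, is inherited from N. *)
Lemma is_hopf_module_transport :
  is_hopf_module_iso actN coactN actM coactM f ->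
  is_hopf_module actN coactN -> is_hopf_module actM coactM.
Proof.
case=> fL [g fK gK] fact fcoact NP; have {}fL : is_linear f := fL.
have gL : is_linear g.
  by move=> c x y; apply: (can_inj fK); rewrite fL !gK.
have actNP : is_bilinear actN := hm_act_bilin NP.
have coactNL : is_linear coactN := hm_coact_linear NP.
have actMP : is_bilinear actM.
  have actE m a : actM m a = f (actN (g m) a) by rewrite fact gK.
  have gP : is_bilinear (fun m a => f (actN (g m) a)) by bilin.
  by split=> z c x y; rewrite !actE; [apply: gP.1 | apply: gP.2].
have coactML : is_linear coactM.
  have coactE m :
    coactM m = \tsum_(n0 \ot n1 <- coactN (g m)) (f n0 \ot n1).
    by rewrite -fcoact gK.
  have gP : is_linear (fun m =>
    \tsum_(n0 \ot n1 <- coactN (g m)) (f n0 \ot n1)) by lin.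
  by move=> c x y; rewrite !coactE gP.
have fid_bilin : is_bilinear (fun n (a : A) => f n \ot a) by bilin.
split=> //.
- by move=> m a b; rewrite -(gK m) -!fact (hm_actA NP).
- by move=> m; rewrite -(gK m) -fact (hm_act1 NP).
- move=> m; rewrite -(gK m) fcoact tsum_subst; last by bilin.
  rewrite -(tsum2_contract fid_bilin (hm_antipodel NP (g m))).
  apply: eq_tsum => n0 n1; rewrite fcoact tsum_subst //; bilin.
- move=> m; rewrite -(gK m) fcoact tsum_subst; last by bilin.
  rewrite -(tsum2_contract fid_bilin (hm_antipoder NP (g m))).
  apply: eq_tsum => n0 n1; rewrite fcoact tsum_subst //; bilin.
- move=> m; rewrite -(gK m) fcoact tsum_subst; last by bilin.
  rewrite -{2}(hopf_module_counit (g m) NP) is_linear_tsum //.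
  by apply: eq_tsum => n0 n1; rewrite is_linearZ.
- move=> m a; rewrite -(gK m) -fact !fcoact (hm_coact_act NP) tsum_subst2 //.
  rewrite tsum_subst; last by bilin.
  apply: eq_tsum => n0 n1; apply: eq_tsum => a1 a2.
  by rewrite fact.
Qed.

End Transport.

(** * The projection onto the coinvariants *)

Section HopfModule.
Variables (k : fieldType) (A : hopfCoquasigroup k) (M : hopfModule A).
Implicit Types (m : M) (a b : A).

Let MP : is_hopf_module (@hm_act k A M) (@hm_coact k A M) := hmP M.
Let act_bilin : is_bilinear (@hm_act k A M) := hm_act_bilin MP.
Let coact_linear : is_linear (@hm_coact k A M) := hm_coact_linear MP.

Definition coinv_proj m : M :=
  \tsum_(m0 \ot m1 <- hm_coact m) hm_act m0 (antipode m1).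

Lemma coinv_proj_linear : is_linear coinv_proj.
Proof. rewrite /coinv_proj; lin. Qed.
Let projL := coinv_proj_linear.

(** The coaction of m <| a yields m0 <| (a1 S(a2) S(m1)), since the antipode
    reverses products. *)
Lemma coinv_proj_act m a :
  coinv_proj (hm_act m a) = (counit a : k) *: coinv_proj m.
Proof.
rewrite /coinv_proj (hm_coact_act MP) tsum_subst2; last by bilin.
rewrite scaler_tsum.
apply: eq_tsum => m0 m1.
have h : is_linear (fun x => hm_act m0 (x * antipode m1)) by lin.
transitivity (hm_act m0 (((counit a : k) *: 1) * antipode m1)).
  rewrite -antipode_mulr (is_linear_tsum h).
  by apply: eq_tsum => a1 a2; rewrite (hm_actA MP) antipodeM mulrA.
have h2 : is_linear (hm_act m0) by lin.
by rewrite -scalerAl mul1r (is_linearZ h2).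
Qed.

(** The inverse of [sigma], followed by the inclusion of the coinvariants in M.
    Working in M \ot A makes this map available before [coinv_proj] is known to
    take coinvariant values. *)
Definition trivialization m : (M \ot A)%type :=
  \tsum_(m0 \ot m1 <- hm_coact m) (coinv_proj m0 \ot m1).

Lemma trivialization_act m a :
  trivialization (hm_act m a) =
  \tsum_(m0 \ot m1 <- hm_coact m) (coinv_proj m0 \ot (m1 * a)).
Proof.
rewrite /trivialization (hm_coact_act MP) tsum_subst2; last by bilin.
apply: eq_tsum => m0 m1; rewrite -{2}[a]counitl.
have fl : is_linear (fun x => coinv_proj m0 \ot (m1 * x)) by lin.
rewrite (is_linear_tsum fl).
apply: eq_tsum => a1 a2; rewrite coinv_proj_act -scalerAr.
have tl : is_linear (fun u : M => u \ot (m1 * a2)) by lin.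
have tr : is_linear (fun v : A => coinv_proj m0 \ot v) by lin.
by rewrite (is_linearZ tl) (is_linearZ tr).
Qed.

Lemma trivialization_linear : is_linear trivialization.
Proof. rewrite /trivialization; lin. Qed.
Let trivL := trivialization_linear.

(** By A-linearity the left-hand side is P m00 \ot m01 S(m1), which is the axiom
    [hm_antipoder] with P applied to its left factor. *)
Lemma trivialization_proj m :
  trivialization (coinv_proj m) = coinv_proj m \ot 1.
Proof.
have f_bilin : is_bilinear (fun u (v : A) => coinv_proj u \ot v) by bilin.
rewrite -(tsum2_contract f_bilin (hm_antipoder MP m)).
rewrite {1}/coinv_proj (is_linear_tsum trivL).
by apply: eq_tsum => m0 m1; rewrite trivialization_act.
Qed.

(** The left-hand side is m00 <| (S(m01) m1), so [hm_antipodel] applies. *)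
Lemma act_trivialization m :
  \tsum_(m0 \ot m1 <- hm_coact m) hm_act (coinv_proj m0) m1 = m.
Proof.
rewrite -{2}(hm_act1 MP m) -(tsum2_contract act_bilin (hm_antipodel MP m)).
apply: eq_tsum => m0 m1.
have act_l : is_linear (fun u : M => hm_act u m1) by lin.
rewrite /coinv_proj (is_linear_tsum act_l).
by apply: eq_tsum => m00 m01; rewrite (hm_actA MP).
Qed.

(** The coaction that [sigma] carries over from the free module, at the image
    of u \ot a, but defined for all u. *)
Definition free_coact (u : M) (a : A) : (M \ot A)%type :=
  \tsum_(a1 \ot a2 <- comul a) (hm_act u a1 \ot a2).

Lemma free_coact_bilinear : is_bilinear free_coact.
Proof. rewrite /free_coact; bilin. Qed.
Let fcP := free_coact_bilinear.

(** The action by S(m01) m11 in the induced coaction is the action by S(m01),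
    which completes P m0, followed by that of m11. *)
Lemma induced_coactE m : induced_coact m = tsum free_coact (trivialization m).
Proof.
rewrite tsum_subst //; apply: eq_tsum => m0 m1.
have fl : is_linear (free_coact^~ m1) by lin.
rewrite (is_linear_tsum fl); apply: eq_tsum => m00 m01.
by apply: eq_tsum => m11 m12; rewrite (hm_actA MP).
Qed.

Lemma proj_coinvariant m : coinvariant (coinv_proj m).
Proof.
apply/eqP; rewrite induced_coactE trivialization_proj tsum_tpure //.
rewrite /free_coact (comul_monoid_morphism A).1 tsum_tpure; last by bilin.
by rewrite (hm_act1 MP).
Qed.

(** Apply the counit to the right factor in [trivialization_proj]. *)
Lemma coinv_proj_idem m : coinv_proj (coinv_proj m) = coinv_proj m.
Proof.
pose f (u : M) (v : A) := (counit v : k) *: u.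
have f_bilin : is_bilinear f by rewrite /f; bilin.
have := congr1 (tsum f) (trivialization_proj m).
rewrite tsum_subst // tsum_tpure // /f rmorph1 scale1r => e; rewrite -[RHS]e.
rewrite -{1}(hopf_module_counit (coinv_proj m) MP) (is_linear_tsum projL).
by apply: eq_tsum => m0 m1; rewrite (is_linearZ projL).
Qed.

(** Applying P to the left factor of the induced coaction of any m gives
    P (P m0 <| m11) \ot m12 = P m0 \ot m1, while the same operation on m \ot 1
    gives P m \ot 1. *)
Lemma trivialization_coinv m :
  coinvariant m -> trivialization m = coinv_proj m \ot 1.
Proof.
have f_bilin : is_bilinear (fun (u : M) (v : A) => coinv_proj u \ot v) by bilin.
move=> /eqP mP.
have := congr1 (tsum (fun (u : M) (v : A) => coinv_proj u \ot v)) mP.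
rewrite tsum_tpure // => <-; rewrite induced_coactE tsum_subst //.
rewrite tsum_tsum //; apply: eq_tsum => m0 m1.
rewrite tsum_subst // -{1}[m1]counitl.
have tr : is_linear (fun v : A => coinv_proj m0 \ot v) by lin.
rewrite (is_linear_tsum tr); apply: eq_tsum => a1 a2.
have tl : is_linear (fun u : M => u \ot a2) by lin.
by rewrite coinv_proj_act coinv_proj_idem (is_linearZ tl) (is_linearZ tr).
Qed.

Lemma coinv_proj_coinv m : coinvariant m -> coinv_proj m = m.
Proof.
move=> mP; rewrite -{2}[m]act_trivialization -(tsum_subst act_bilin).
rewrite -/(trivialization m) (trivialization_coinv mP) tsum_tpure //.
by rewrite (hm_act1 MP).
Qed.

Lemma trivialization_coinv_act m a :
  coinvariant m -> trivialization (hm_act m a) = m \ot a.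
Proof.
move=> mP; rewrite trivialization_act.
have f_bilin : is_bilinear (fun (u : M) (v : A) => u \ot (v * a)) by bilin.
by rewrite -(tsum_subst f_bilin) -/(trivialization m) (trivialization_coinv mP)
  tsum_tpure // mul1r coinv_proj_coinv.
Qed.

(** * The isomorphism *)

Definition to_coinv m : coinv M := Coinv (proj_coinvariant m).

Lemma coinv_val_linear : is_linear (@coinv_val k A M).
Proof. by move=> c x y; exact: (linearP (val : {linear coinv M -> M})). Qed.
Let valL := coinv_val_linear.

Lemma to_coinv_linear : is_linear to_coinv.
Proof. by move=> c x y; apply: val_inj => /=; rewrite projL. Qed.
Let toL := to_coinv_linear.

Lemma to_coinv_proj m : to_coinv (coinv_proj m) = to_coinv m.
Proof. by apply: val_inj; apply: coinv_proj_idem. Qed.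

Lemma to_coinvK : cancel (@coinv_val k A M) to_coinv.
Proof. by move=> m; apply: val_inj; apply: coinv_proj_coinv (coinvP m). Qed.

Lemma sigma_linear : is_linear (@sigma k A M).
Proof. rewrite /sigma; lin. Qed.
Let sigmaL := sigma_linear.

Lemma coinv_tens_act_bilinear : is_bilinear (@coinv_tens_act k A M).
Proof. rewrite /coinv_tens_act; bilin. Qed.
Let cactP := coinv_tens_act_bilinear.

Lemma coinv_tens_coact_linear : is_linear (@coinv_tens_coact k A M).
Proof. rewrite /coinv_tens_coact; lin. Qed.
Let ccoactL := coinv_tens_coact_linear.

Lemma coinv_tens_act_pure (u : coinv M) a b :
  coinv_tens_act (u \ot a) b = u \ot (a * b).
Proof. by apply: tsum_tpure; bilin. Qed.

Lemma coinv_tens_coact_pure (u : coinv M) a :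
  coinv_tens_coact (u \ot a) =
  \tsum_(a1 \ot a2 <- comul a) ((u \ot a1) \ot a2).
Proof. by apply: tsum_tpure; bilin. Qed.

Lemma sigma_pure (u : coinv M) a : sigma (u \ot a) = hm_act (u : M) a.
Proof. by apply: tsum_tpure; bilin. Qed.

(** Since the coaction touches only the factor A, each axiom at u \ot c is the
    corresponding axiom of A at c, tensored with u. *)
Lemma coinv_tens_hopf_module :
  is_hopf_module (@coinv_tens_act k A M) coinv_tens_coact.
Proof.
split=> //.
- move=> t a b; move: t; apply: tens_linear_ext; [lin | lin |] => u c.
  by rewrite !coinv_tens_act_pure mulrA.
- apply: tens_linear_ext; [lin | lin |] => u c.
  by rewrite !coinv_tens_act_pure mulr1.
- apply: tens_linear_ext; [lin | lin |] => u c.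
  have f_bilin : is_bilinear (fun x y : A => (u \ot x) \ot y) by bilin.
  rewrite coinv_tens_coact_pure -(tsum2_contract f_bilin (antipode_rl c)).
  rewrite tsum_subst; last by bilin.
  apply: eq_tsum => c1 c2; rewrite coinv_tens_coact_pure tsum_subst //; bilin.
- apply: tens_linear_ext; [lin | lin |] => u c.
  have f_bilin : is_bilinear (fun x y : A => (u \ot x) \ot y) by bilin.
  rewrite coinv_tens_coact_pure -(tsum2_contract f_bilin (antipode_rr c)).
  rewrite tsum_subst; last by bilin.
  apply: eq_tsum => c1 c2; rewrite coinv_tens_coact_pure tsum_subst //; bilin.
- apply: tens_linear_ext; [lin | lin |] => u c.
  rewrite coinv_tens_coact_pure -{2}[c]counitr tsum_subst; last by bilin.
  have tr : is_linear (fun v : A => u \ot v) by lin.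
  rewrite (is_linear_tsum tr).
  by apply: eq_tsum => c1 c2; rewrite (is_linearZ tr).
- move=> t a; move: t; apply: tens_linear_ext; [lin | lin |] => u c.
  rewrite coinv_tens_act_pure !coinv_tens_coact_pure comulM.
  rewrite tsum_subst2; last by bilin.
  rewrite tsum_subst; last by bilin.
  apply: eq_tsum => c1 c2; apply: eq_tsum => a1 a2.
  by rewrite coinv_tens_act_pure.
Qed.

Definition sigma_inv m : (coinv M \ot A)%type :=
  \tsum_(m0 \ot m1 <- hm_coact m) (to_coinv m0 \ot m1).

Lemma sigma_inv_linear : is_linear sigma_inv.
Proof. rewrite /sigma_inv; lin. Qed.
Let sigma_invL := sigma_inv_linear.

Lemma sigma_invK : cancel sigma_inv (@sigma k A M).
Proof.
move=> m; rewrite -{2}[m]act_trivialization /sigma_inv (is_linear_tsum sigmaL).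
by apply: eq_tsum => m0 m1; rewrite sigma_pure.
Qed.

(** The value of [sigma_inv] is computed from [trivialization], which lies in
    M \ot A, by retracting M onto the coinvariants; this avoids having to know
    that the inclusion remains injective after tensoring with A. *)
Lemma sigmaK : cancel (@sigma k A M) sigma_inv.
Proof.
apply: tens_linear_ext; [lin | lin |] => u a.
have f_bilin : is_bilinear (fun (x : M) (v : A) => to_coinv x \ot v) by bilin.
rewrite sigma_pure.
have -> m : sigma_inv m =
    tsum (fun (x : M) (v : A) => to_coinv x \ot v) (trivialization m).
  by rewrite tsum_subst //; apply: eq_tsum => m0 m1; rewrite to_coinv_proj.
rewrite trivialization_coinv_act ?tsum_tpure ?to_coinvK //.
exact: coinvP.
Qed.

Lemma sigma_hopf_module_iso :
  is_hopf_module_iso (@coinv_tens_act k A M) coinv_tens_coact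
    (@hm_act k A M) induced_coact (@sigma k A M).
Proof.
split=> //.
- by exists sigma_inv; [apply: sigmaK | apply: sigma_invK].
- move=> t b; move: t; apply: tens_linear_ext; [lin | lin |] => u a.
  by rewrite coinv_tens_act_pure !sigma_pure (hm_actA MP).
- have indL : is_linear (@induced_coact k A M) := @induced_coact_linear k A M.
  apply: tens_linear_ext; [lin | lin |] => u a.
  rewrite sigma_pure induced_coactE.
  rewrite trivialization_coinv_act; last exact: coinvP.
  rewrite tsum_tpure // coinv_tens_coact_pure tsum_subst; last by bilin.
  by apply: eq_tsum => a1 a2; rewrite sigma_pure.
Qed.

End HopfModule.

Theorem theorem4p4 (k : fieldType) (A : hopfCoquasigroup k) (M : hopfModule A) :
  [/\ is_hopf_module (@hm_act k A M) induced_coact,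
      is_hopf_module (@coinv_tens_act k A M) coinv_tens_coact,
      is_hopf_module_iso (@coinv_tens_act k A M) coinv_tens_coact
        (@hm_act k A M) induced_coact (@sigma k A M)
    & exists E : M -> coinv M,
        (forall m, (E m : M) =
           \tsum_(m0 \ot m1 <- hm_coact m) hm_act m0 (antipode m1)) /\
        let sigma_inv m := \tsum_(m0 \ot m1 <- hm_coact m) (E m0 \ot m1) in
        cancel (@sigma k A M) sigma_inv /\ cancel sigma_inv (@sigma k A M)].
Proof.
have isoP := sigma_hopf_module_iso M; have freeP := coinv_tens_hopf_module M.
split=> //; first exact: is_hopf_module_transport isoP freeP.
exists (@to_coinv k A M); split=> //; split; [exact: sigmaK | exact: sigma_invK].
Qed.
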